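(* Let $s\in\mathbb{N}$, $0<\alpha\le1$, $p>\alpha^{-1}$ (with $p\le\infty$), and $q\in[1,\infty]$. For every point set $P=\{\mathbf{x}_0,\dots,\mathbf{x}_{N-1}\}\subset[0,1]^s$ we have $$e^{\mathrm{wor}}(Q_P,\mathcal{H}_{\alpha,s,p,q})=D^*_{\alpha,s,p',q'}(P),$$ where $Q_P(f)=\frac1N\sum_{n=0}^{N-1}f(\mathbf{x}_n)$ and $1/p+1/p'=1=1/q+1/q'$.
   Context: Let $S=\{1,\dots,s\}$. For $u\subseteq S$ write $\mathbf{t}_u=(t_j)_{j\in u}\in[0,1]^u$; $(x-t)_+^{\alpha-1}$ means $(x-t)^{\alpha-1}$ if $x>t$ and $0$ otherwise. Convention: $L_p([0,1]^\emptyset)=\mathbb{R}$ with absolute value as norm, and the integral over $[0,1]^\emptyset$ of $\tilde f_\emptyset$ is $\tilde f_\emptyset$. Space of fractional smoothness: $\mathcal{H}_{\alpha,s,p}$ is the set of functions $f:[0,1]^s\to\mathbb{R}$ of the form $f(\mathbf{x})=\sum_{u\subseteq S}\Gamma(\alpha)^{-|u|}\int_{[0,1]^u}\tilde f_u(\mathbf{t}_u)\prod_{j\in u}(x_j-t_j)_+^{\alpha-1}\,d\mathbf{t}_u$ with $\tilde f_u\in L_p([0,1]^u)$ for all $u\subseteq S$. The functions $\tilde f_u$ are uniquely determined (a.e.) by $f$, and $\mathcal{H}_{\alpha,s,p,q}$ denotes this space with the norm $\|f\|_{\alpha,s,p,q}=\big(\sum_{u\subseteq S}\Gamma(\alpha)^{-q|u|}\|\tilde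 f_u\|^q_{L_p}\big)^{1/q}$ (usual modification for $q=\infty$). Fractional discrepancy: for $\emptyset\ne u\subseteq S$ and $\mathbf{t}_u\in[0,1]^u$, $\Delta_\alpha(\mathbf{t}_u,u,P)=\alpha^{-|u|}\prod_{j\in u}(1-t_j)^\alpha-\frac1N\sum_{n=0}^{N-1}\prod_{j\in u}(x_{n,j}-t_j)_+^{\alpha-1}$, where $\mathbf{x}_n=(x_{n,1},\dots,x_{n,s})$, and $D^*_{\alpha,s,p',q'}(P)=\Big(\sum_{\emptyset\ne u\subseteq S}\big(\int_{[0,1]^u}|\Delta_\alpha(\mathbf{t}_u,u,P)|^{p'}d\mathbf{t}_u\big)^{q'/p'}\Big)^{1/q'}$ with the obvious modifications for $q'=\infty$. $e^{\mathrm{wor}}(Q_P,\mathcal{H}_{\alpha,s,p,q})=\sup\{|\int_{[0,1]^s}f-Q_P(f)|: f\in\mathcal{H}_{\alpha,s,p},\|f\|_{\alpha,s,p,q}\le1\}$. *)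

(* Defs.v *)
From HB Require Import structures.
From mathcomp Require Import all_boot all_order all_algebra.
From mathcomp Require Import all_classical all_reals all_analysis.
Unset Printing Implicit Defensive.
Import Order.TTheory GRing.Theory Num.Theory.
Import numFieldNormedType.Exports.
Local Open Scope classical_set_scope.
Local Open Scope ring_scope.

Section Defs.
Context {R : realType}.

(* k-dimensional Lebesgue measure on k.-tuple R (product Borel sigma-algebra
   from the library), defined as the iterated product measure via sections:
   lebn 0 = Dirac mass at the empty tuple,
   lebn (n+1) A = int_R lebn n {t | (x :: t) in A} dx. *)
Fixpoint lebn (n : nat) : set (n.-tuple R) -> \bar R :=
  match n return set (n.-tuple R) -> \bar R with
  | 0 => fun A => if `[< A [tuple] >] then 1%E else 0%E
  | n'.+1 => fun A =>
      (\int[@lebesgue_measure R]_x lebn n' [set t | A (cons_tuple x t)])%E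
  end.

Definition cube (k : nat) : set (k.-tuple R) :=
  [set t | forall i, 0 <= tnth t i <= 1].

Definition Gamma (a : R) : R :=
  fine (\int[@lebesgue_measure R]_(t in `]0%R, +oo[)
           ((t `^ (a - 1)) * expR (- t))%:E)%E.

Definition ppow (a y : R) : R := if 0 < y then y `^ (a - 1) else 0.

(* coordinates of t_u in [0,1]^u are indexed by 'I_#|u|, the i-th one
   corresponding to the coordinate enum_val i \in u of [0,1]^s *)
Definition kern (s : nat) (a : R) (u : {set 'I_s}) (x : s.-tuple R)
    (t : #|u|.-tuple R) : R :=
  \prod_(i < #|u|) ppow a (tnth x (enum_val i) - tnth t i).

Definition Lpn (k : nat) (p : \bar R) (g : k.-tuple R -> R) : \bar R :=
  match p with
  | r%:E => ((\int[lebn k]_(t in cube k) ((`|g t| `^ r)%:E)) `^ r^-1)%E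
  | +oo%E => ereal_inf [set M : \bar R |
                lebn k (cube k `&` [set t | (M < (`|g t|)%:E)%E]) = 0%E]
  | -oo%E => 0%E
  end.

Definition inLp (k : nat) (p : \bar R) (g : k.-tuple R -> R) : Prop :=
  measurable_fun (cube k) g /\ (Lpn k p g < +oo)%E.

Definition conjexp (p : \bar R) : \bar R :=
  match p with
  | r%:E => if r == 1 then +oo%E else (r / (r - 1))%:E
  | +oo%E => 1%E
  | -oo%E => 0%E
  end.

Definition lqsum (q : \bar R) {I : finType} (P : pred I) (a : I -> \bar R)
    : \bar R :=
  match q with
  | r%:E => ((\sum_(i | P i) (a i `^ r)) `^ r^-1)%E
  | +oo%E => (\big[maxe/0%E]_(i | P i) a i)%E
  | -oo%E => 0%E
  end.

Definition family (s : nat) := forall u : {set 'I_s}, #|u|.-tuple R -> R.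

Definition represents (s : nat) (a : R) (F : family s)
    (f : s.-tuple R -> R) : Prop :=
  forall x, cube s x ->
    (f x)%:E = (\sum_(u : {set 'I_s})
       ((Gamma a)^-1 ^+ #|u|)%:E *
       \int[lebn #|u|]_(t in cube #|u|) (F u t * kern s a u x t)%:E)%E.

Definition Hnorm (s : nat) (a : R) (p q : \bar R) (F : family s) : \bar R :=
  lqsum q predT (fun u : {set 'I_s} =>
    (((Gamma a)^-1 ^+ #|u|)%:E * Lpn #|u| p (F u))%E).

Definition Hball (s : nat) (a : R) (p q : \bar R) : set (s.-tuple R -> R) :=
  [set f : s.-tuple R -> R | exists F : family s,
     (forall u : {set 'I_s}, inLp #|u| p (F u)) /\ represents s a F f /\ (Hnorm s a p q F <= 1)%E].

Definition QP (s N : nat) (X : 'I_N -> s.-tuple R) (f : s.-tuple R -> R) : R :=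
  N%:R^-1 * \sum_(n < N) f (X n).

Definition ewor (s : nat) (a : R) (p q : \bar R) (N : nat)
    (X : 'I_N -> s.-tuple R) : \bar R :=
  ereal_sup [set `| (\int[lebn s]_(x in cube s) (f x)%:E - (QP s N X f)%:E)%E |%E
            | f in Hball s a p q].

Definition Delta (s : nat) (a : R) (u : {set 'I_s}) (N : nat)
    (X : 'I_N -> s.-tuple R) (t : #|u|.-tuple R) : R :=
  a ^- #|u| * \prod_(i < #|u|) ((1 - tnth t i) `^ a)
  - N%:R^-1 * \sum_(n < N) kern s a u (X n) t.

Definition Dstar (s : nat) (a : R) (p' q' : \bar R) (N : nat)
    (X : 'I_N -> s.-tuple R) : \bar R :=
  lqsum q' [pred u : {set 'I_s} | u != finset.set0]
    (fun u => Lpn #|u| p' (Delta s a u N X)).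

End Defs.

(* Main.v *)
Require Import Defs.
From HB Require Import structures.
From mathcomp Require Import all_boot all_order all_algebra.
From mathcomp Require Import all_classical all_reals all_analysis.
From mathcomp Require Import measurable_realfun ess_sup_inf ring lra.
Import Order.TTheory GRing.Theory Num.Theory.
Import numFieldNormedType.Exports.
Local Open Scope classical_set_scope.
Local Open Scope ring_scope.

(** Applying Fubini to the representation of [f] and using
    [int_0^1 (x - t)_+^(alpha-1) dx = (1 - t)^alpha / alpha], the integration
    error of [f] becomes [sum_u Gamma(alpha)^-|u| int F_u Delta_u], where the
    term [u = set0] vanishes.  Hoelder's inequality, first for the integrals and
    then for the sum over [u], bounds it by the discrepancy; it is attained
    since both Hoelder inequalities have extremal functions.  The hypothesis
    [p > alpha^-1] says that the kernel is in [L_p'], so that everything is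
    finite. *)

(** * Lebesgue measure on the cube *)

(** [lebn] is a bare set function, so theorems about measures do not apply to it directly. Integrals
    over the cube are therefore moved to the probability measure [cube_prob], and functions known
    only on the cube are extended by zero. Truncated powers are stable under what the proof does to
    them: the [r]-th power of the kernel of order [a] is the kernel of order [r * (a - 1) + 1], and
    on the cube the integral over [x] of the kernel of order [a] is a multiple of a kernel of order
    [a + 1]. For finite [p] and [r = p'] the first order equals [(p * a - 1) / (p - 1)], which is
    positive exactly when [p > 1 / a]; membership in L_p' thus reduces to integrating a kernel of
    positive order. The empty set counts in the norm of [f] but not in the discrepancy. This
    mismatch is harmless because the rule integrates constants exactly, and it is why the discrete
    duality below takes one norm over all indices and the other over a subset. *)

Section CubeMeasure.
Context {R : realType}.
Local Open Scope ereal_scope.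

Definition cons_pair n (z : measurableTypeR R * n.-tuple R) : n.+1.-tuple R :=
  cons_tuple z.1 z.2.

Lemma measurable_cons_pair n : measurable_fun setT (@cons_pair n).
Proof.
by apply: (@measurable_cons _ _ _ R fst) => //; exact: measurable_fst.
Qed.

HB.instance Definition _ n :=
  isMeasurableFun.Build _ _ _ _ (@cons_pair n) (@measurable_cons_pair n).

(** The uniform distribution on the cube. It follows the recursion of [lebn] on the first
    coordinate, but as a bundled probability, so that Tonelli, Fubini and Hoelder are available. *)
Fixpoint cube_prob n : probability (n.-tuple R) R :=
  match n return probability (n.-tuple R) R with
  | 0 => dirac (nil_tuple R) : probability _ _
  | n'.+1 => distribution (uniform_prob (@ltr01 R) \x cube_prob n')
               (@cons_pair n') : probability _ _
  end.

Lemma measurable_cube n : measurable (@cube R n).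
Proof.
rewrite (_ : cube n = \bigcap_(i in [set: 'I_n])
    ((fun t : n.-tuple R => tnth t i) @^-1` `[0%R, 1%R])).
  apply: fin_bigcap_measurable => // i _.
  by rewrite -[X in measurable X]setTI; exact: measurable_tnth.
apply/seteqP; split=> [t ct i _|t ct i]; first by rewrite /= in_itv/= ct.
by have := ct i I; rewrite /= in_itv.
Qed.

Lemma cube_cons n (x : R) (t : n.-tuple R) :
  cube n.+1 (cons_tuple x t) <-> (0 <= x <= 1)%R /\ cube n t.
Proof.
split=> [ct|[x01 ct] i].
  split; first by have := ct ord0; rewrite tnth0.
  by move=> i; have := ct (lift ord0 i); rewrite tnthS.
by case: (unliftP ord0 i) => [j ->|->]; rewrite ?tnthS ?tnth0.
Qed.

Lemma lebn_set0 n : @lebn R n set0 = 0.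
Proof.
elim: n => [|n IH] /=; first by case: asboolP.
by rewrite integral0_eq// => x _; rewrite -[RHS]IH.
Qed.

(** By induction on sections: for [x] outside [[0, 1]] the section of the intersection is empty, and
    on [[0, 1]] Lebesgue measure is the uniform probability. *)
Lemma lebn_cubeI n (A : set (n.-tuple R)) : measurable A ->
  lebn n (A `&` cube n) = cube_prob n A.
Proof.
elim: n A => [|n IH] A mA /=.
  rewrite diracE; case: asboolP => h; first by rewrite mem_set//; case: h.
  by rewrite memNset// => A0; apply: h; split=> // -[].
have mA' : measurable (@cons_pair n @^-1` A).
  by rewrite -[X in measurable X]setTI; exact: measurable_cons_pair.
rewrite /distribution/= /pushforward /product_measure1.
rewrite integral_uniform//; last first.
  exact: measurable_fun_xsection.
rewrite subr0 invr1 mul1e [RHS]integral_mkcond; apply: eq_integral => x _.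
rewrite patchE; case: ifPn => [|]; rewrite ?notin_setE ?inE /= in_itv/= => x01.
  rewrite -IH; last exact: measurable_xsection.
  congr lebn; apply/seteqP; split=> t /=.
    by case=> At /cube_cons[_ ct]; split => //; apply/mem_set.
  by rewrite /xsection/= => -[/set_mem At ct]; split => //; apply/cube_cons.
rewrite [X in lebn n X](_ : _ = set0) ?lebn_set0//.
by apply/seteqP; split=> // t [_ /cube_cons[]].
Qed.

Lemma cube_prob_cube n : cube_prob n (cube n) = 1.
Proof.
elim: n => [|n IH] /=.
  by rewrite diracE mem_set//= => -[].
rewrite /distribution/= /pushforward /product_measure1.
have mA' : measurable (@cons_pair n @^-1` cube n.+1).
  rewrite -[X in measurable X]setTI; apply: measurable_cons_pair => //.
  exact: measurable_cube.
rewrite integral_uniform//; last exact: measurable_fun_xsection.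
rewrite subr0 invr1 mul1e.
rewrite (eq_integral (cst 1)).
  by rewrite integral_cst//= mul1e lebesgue_measure_itv/= lte_fin ltr01 sube0.
move=> x; rewrite inE/= in_itv/= => x01; rewrite -[RHS]IH; congr (cube_prob _ _).
apply/seteqP; split=> t; rewrite /xsection/=.
  by move=> /set_mem/cube_cons[].
by move=> ct; apply/mem_set/cube_cons.
Qed.

Import HBNNSimple.

(** The supremum inside the definition of the integral, for an arbitrary set function. *)
Let nnintegral n (mu : set (n.-tuple R) -> \bar R) f := ereal_sup
  [set sintegral mu h | h in
    [set h : {nnsfun n.-tuple R >-> R} | forall x, (h x)%:E <= f x]].

(* For a simple function supported in the cube only the level set of [0], whose
   weight is [0], is not contained in the cube. *)
Let nnintegral_lebn n (f : n.-tuple R -> \bar R) :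
  (forall t, 0 <= f t) -> (forall t, ~ cube n t -> f t = 0) ->
  nnintegral n (lebn n) f = nnintegral n (cube_prob n) f.
Proof.
move=> f0 fcube.
have E (h : {nnsfun n.-tuple R >-> R}) : (forall t, (h t)%:E <= f t) ->
    sintegral (lebn n) h = sintegral (cube_prob n) h.
  move=> hf; rewrite /sintegral; apply: eq_fsbigr => x _.
  have [->|x0] := eqVneq x 0%R; first by rewrite !mul0e.
  congr (_ * _); rewrite -lebn_cubeI//; congr lebn.
  apply/seteqP; split=> t /=; last by case.
  move=> htx; split => //; apply: contrapT => /fcube ft0.
  have := hf t; rewrite ft0 lee_fin htx => xle0.
  have xge0 : (0 <= x)%R by rewrite -htx; exact: fun_ge0.
  by move: x0; rewrite eq_le xle0 xge0.
rewrite /nnintegral; congr ereal_sup.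
by apply/seteqP; split=> _ [h /= hf <-]; exists h; rewrite ?E.
Qed.

(** No measurability of [f] is required: the integral is a supremum over simple functions, which are
    themselves measurable. *)
Lemma integral_lebn_cube n (f : n.-tuple R -> \bar R) :
  \int[lebn n]_(t in cube n) f t = \int[cube_prob n]_(t in cube n) f t.
Proof.
rewrite /integral; congr (_ - _); apply: nnintegral_lebn => t.
- exact: funepos_ge0.
- by move=> ct; rewrite funeposE patchE memNset// maxxx.
- exact: funeneg_ge0.
- by move=> ct; rewrite funenegE patchE memNset// oppe0 maxxx.
Qed.

(** The complement of the cube is a null set of [cube_prob], so the domain can be enlarged to the
    whole space when [f] is measurable. *)
Lemma integral_lebn n (f : n.-tuple R -> \bar R) :
  measurable_fun [set: n.-tuple R] f ->
  \int[lebn n]_(t in cube n) f t = \int[cube_prob n]_t f t.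
Proof.
move=> mf; rewrite integral_lebn_cube; have mc := measurable_cube n.
have cC : cube_prob n (~` cube n) = 0.
  rewrite probability_setC; last exact: mc.
  by rewrite cube_prob_cube subee.
rewrite [LHS]integralE [RHS]integralE; congr (_ - _).
  rewrite [RHS](@ge0_negligible_integral _ _ _ _ _ (~` cube n))//.
  - by rewrite setDE setTI setCK.
  - exact: measurableC.
  - exact: measurable_funepos.
rewrite [RHS](@ge0_negligible_integral _ _ _ _ _ (~` cube n))//.
- by rewrite setDE setTI setCK.
- exact: measurableC.
- exact: measurable_funeneg.
Qed.

Lemma ge0_integral_cube_probS n (f : n.+1.-tuple R -> \bar R) :
  measurable_fun [set: n.+1.-tuple R] f -> (forall t, 0 <= f t) ->
  \int[cube_prob n.+1]_t f t =
  \int[uniform_prob (@ltr01 R)]_x \int[cube_prob n]_t f (cons_tuple x t).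
Proof.
move=> mf f0; rewrite /= ge0_integral_distribution//.
have mg : measurable_fun setT (f \o @cons_pair n).
  by apply: measurableT_comp => //; exact: measurable_cons_pair.
by rewrite fubini_tonelli1 => [|//|z]; [|exact: f0].
Qed.

Lemma integral_cube_prob_prod n (g : 'I_n -> R -> R) :
  (forall i, measurable_fun setT (g i)) -> (forall i x, 0 <= g i x)%R ->
  \int[cube_prob n]_t (\prod_(i < n) g i (tnth t i))%:E =
  \prod_(i < n) \int[lebesgue_measure]_(x in `[0%R, 1%R]) (g i x)%:E.
Proof.
elim: n g => [|n IH] g mg g0.
  rewrite big_ord0 [X in \int[X]_t _]/=; under eq_integral do rewrite big_ord0.
  by rewrite integral_cst//= diracT mul1e.
(* Stated for every length, as it is needed both for [n.+1] and for the tail of length [n]. *)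
have mprod m (h : 'I_m -> R -> R) : (forall i, measurable_fun setT (h i)) ->
    measurable_fun [set: m.-tuple R]
      (fun t : m.-tuple R => (\prod_(i < m) h i (tnth t i))%:E).
  move=> mh; apply/measurable_EFinP; apply: measurable_prod => i _.
  by apply: measurableT_comp => //; exact: measurable_tnth.
rewrite ge0_integral_cube_probS//; last 2 first.
- exact: mprod.
- by move=> t; rewrite lee_fin prodr_ge0.
rewrite big_ord_recl -(IH (fun i => g (lift ord0 i)))//.
set K := \int[cube_prob n]_t _.
have K0 : 0 <= K by apply: integral_ge0 => t _; rewrite lee_fin prodr_ge0.
transitivity (\int[uniform_prob (@ltr01 R)]_x ((g ord0 x)%:E * K)).
  apply: eq_integral => x _.
  rewrite (eq_integral (fun t : n.-tuple R => (g ord0 x)%:E *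
      (\prod_(i < n) g (lift ord0 i) (tnth t i))%:E)); last first.
    move=> t _; rewrite -EFinM big_ord_recl/= tnth0.
    by under eq_bigr do rewrite tnthS.
  rewrite ge0_integralZl//.
  - exact: (mprod n (fun i => g (lift ord0 i))).
  - by move=> t _; rewrite lee_fin prodr_ge0.
  - by rewrite lee_fin.
rewrite integral_uniform; last 2 first.
- by apply: emeasurable_funM => //; apply/measurable_EFinP; exact: mg.
- by move=> x; rewrite mule_ge0// lee_fin.
rewrite subr0 invr1 mul1e ge0_integralZr//.
- by apply/measurable_EFinP; apply: measurable_funTS; exact: mg.
- by move=> x _; rewrite lee_fin.
Qed.

End CubeMeasure.

(** * One-dimensional integrals and the Gamma function *)

Section OneDim.
Context {R : realType}.
Local Notation mu := (@lebesgue_measure R).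

Lemma measurable_ppow (b : R) : measurable_fun setT (ppow b).
Proof. by apply: measurable_fun_ifT => //; exact: measurable_fun_ltr. Qed.

Lemma ppow_ge0 (b x : R) : 0 <= ppow b x.
Proof. by rewrite /ppow; case: ifP => // _; exact: powR_ge0. Qed.

Definition reflect_at (c : R) (x : measurableTypeR R) : measurableTypeR R :=
  c - (x : R).

Lemma measurable_reflect_at c :
  measurable_fun [set: measurableTypeR R] (reflect_at c).
Proof. by apply: (@measurable_funB _ _ _ _ (cst c) id). Qed.

Lemma lebesgue_measure_reflect (c : R) (A : set R) : measurable A ->
  pushforward mu (reflect_at c) A = mu A.
Proof.
move=> mA; apply/esym/lebesgue_measure_unique => //=.
  exact: measurable_reflect_at.
move=> _ _ [[a b]] _ <-.
rewrite /pushforward.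
(* Reflection moves the closed end of the half-open interval to the other side; the length is
   unchanged. *)
rewrite [X in _ = mu X](_ : _ = [set` `[c - b, c - a[]).
  rewrite !lebesgue_measure_itv/= !lte_fin ltrD2l ltrN2.
  by case: ifP => // _; rewrite -!EFinB; congr EFin; ring.
by apply/seteqP; split=> x/=; rewrite /reflect_at !in_itv/= => /andP[? ?];
    apply/andP; split; lra.
Qed.

Lemma ge0_integral_reflect (c : R) (f : R -> \bar R) :
  measurable_fun [set: R] f -> (forall x, 0 <= f x)%E ->
  (\int[mu]_(x in `[0%R, c]) f (c - x)%R = \int[mu]_(x in `[0%R, c]) f x)%E.
Proof.
move=> mf f0.
have E : reflect_at c @^-1` `[0, c] = `[0, c]%classic.
  by apply/seteqP; split=> x/=; rewrite /reflect_at !in_itv/= => /andP[? ?];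
    apply/andP; split; lra.
rewrite -[in LHS]E.
rewrite -(@ge0_integral_pushforward _ _ _ _ _ (reflect_at c) _ _ _ f)//;
  last first.
- exact: measurable_funTS.
- exact: measurable_reflect_at.
apply: eq_measure_integral => //=; first exact: measurable_reflect_at.
by move=> _ A mA _; exact: lebesgue_measure_reflect.
Qed.

Lemma derivable_powR_div (b x : R) : 0 < x ->
  derivable (fun x : R => x `^ b / b) x 1.
Proof.
move=> x0; apply: derivableM => //.
by apply: derivable_powR; rewrite in_itv/= x0.
Qed.

Lemma derive1_powR_div (b x : R) : 0 < b -> 0 < x ->
  derive1 (fun x => x `^ b / b) x = ppow b x.
Proof.
move=> b0 x0; rewrite /ppow x0 derive1Mr//.
  rewrite powR_derive1 ?in_itv/= ?x0// mulrAC divff ?mul1r// gt_eqF//.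
by apply: derivable_powR; rewrite in_itv/= x0.
Qed.

Lemma integral_ppow_away (b d y : R) : 0 < b -> 0 < d < y ->
  (\int[mu]_(x in `[d, y]) (ppow b x)%:E = (y `^ b / b - d `^ b / b)%:E)%E.
Proof.
move=> b0 /andP[d0 dy].
have cF : {within `[d, y], continuous (fun x : R => x `^ b / b)}.
  apply: derivable_within_continuous => x; rewrite in_itv/= => /andP[dx _].
  by apply: derivable_powR_div; exact: lt_le_trans dx.
rewrite (@continuous_FTC2 _ _ (fun x => x `^ b / b))//.
- have : {within `[d, y], continuous (fun x : R => x `^ (b - 1))}.
    apply: derivable_within_continuous => x; rewrite in_itv/= => /andP[dx _].
    by apply: derivable_powR; rewrite in_itv/= andbT (lt_le_trans d0).
  apply: subspace_eq_continuous => x; rewrite inE/= in_itv/= => /andP[dx _].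
  by rewrite /from_subspace /ppow (lt_le_trans d0 dx).
- move/continuous_within_itvP: cF => /(_ dy)[_ cd cy]; split => // x.
  rewrite in_itv/= => /andP[dx _]; apply: derivable_powR_div.
  exact: lt_trans dx.
- move=> x; rewrite in_itv/= => /andP[dx _]; apply: derive1_powR_div => //.
  exact: lt_trans dx.
Qed.

(** For [b < 1] the integrand is singular at 0, so the fundamental theorem is applied on [[d n, y]]
    only and monotone convergence lets [d n] tend to 0. *)
Lemma integral_ppow (b y : R) : 0 < b -> 0 <= y ->
  (\int[mu]_(x in `[0%R, y]) (ppow b x)%:E = (y `^ b / b)%:E)%E.
Proof.
move=> b0; rewrite le_eqVlt => /predU1P[<-|y0].
  by rewrite set_itv1 integral_set1 powR0 ?mul0r// gt_eqF.
rewrite -integral_itv_obnd_cbnd; last first.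
  by apply/measurable_EFinP/measurable_funTS; exact: measurable_ppow.
(* With [n.+2] the point [d n] lies strictly below [y] already for [n = 0], as [integral_ppow_away]
   demands. *)
pose d n : R := y / n.+2%:R.
have d0 n : 0 < d n by rewrite divr_gt0.
have dy n : d n < y by rewrite ltr_pdivrMr// ltr_pMr// ltr1n.
have cd : d n @[n --> \oo] --> (0 : R).
  rewrite -(mulr0 y); apply: cvgM; first exact: cvg_cst.
  have := @cvg_harmonic R; rewrite -(cvg_shiftS _).
  exact.
pose F n : set R := [set` `[d n, y]].
have FE : `]0%R, y]%classic = \bigcup_n F n.
  apply/seteqP; split=> x/=; last first.
    move=> [n _]; rewrite /F/= !in_itv/= => /andP[dx ->].
    by rewrite (lt_le_trans _ dx).
  rewrite in_itv/= => /andP[x0 xy].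
  have [n _ /(_ n (leqnn n)) dx] := cvgr_lt _ cd x x0.
  by exists n => //; rewrite /F/= in_itv/= xy ltW.
have cF : (\int[mu]_(x in F n) (ppow b x)%:E @[n --> \oo] -->
    \int[mu]_(x in \bigcup_i F i) (ppow b x)%:E)%E.
  apply: ge0_nondecreasing_set_cvg_integral => //.
  - move=> m n mn; apply/subsetPset => x; rewrite /F/= !in_itv/= => /andP[dx ->].
    rewrite andbT (le_trans _ dx)// /d ler_pM2l// lef_pV2 ?posrE//.
    by rewrite ler_nat.
  - by move=> n; exact: measurable_itv.
  - move=> n; apply/measurable_EFinP/measurable_funTS; exact: measurable_ppow.
  - by move=> i x _; rewrite lee_fin ppow_ge0.
have cE : (\int[mu]_(x in F n) (ppow b x)%:E @[n --> \oo] -->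
    (y `^ b / b)%:E)%E.
  have E n : (\int[mu]_(x in F n) (ppow b x)%:E =
      (y `^ b / b - d n `^ b / b)%:E)%E by rewrite /F integral_ppow_away ?d0/=.
  rewrite (_ : (fun n => _) = fun n => (y `^ b / b - d n `^ b / b)%:E).
    apply: cvg_EFin; first exact: nearW.
    rewrite -[X in _ --> X]subr0; apply: cvgB; first exact: cvg_cst.
    rewrite -[X in _ --> X](mul0r b^-1); apply: cvgM; last exact: cvg_cst.
    by have /cvg_at_rightP := powR_cvg0 b0; apply.
  exact/funext.
by rewrite FE -(cvg_lim _ cF)// (cvg_lim _ cE).
Qed.


Lemma mem_segment (a b t : R) : (t \in `[a, b]%classic) = (a <= t <= b).
Proof. by apply/idP/idP; rewrite inE/= in_itv. Qed.

(** The integrand vanishes for [t > x]; on [[0, x]] the reflection [t -> x - t] gives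
    [integral_ppow]. *)
Lemma integral_ppow_backward (b x : R) : 0 < b -> 0 <= x <= 1 ->
  (\int[mu]_(t in `[0%R, 1%R]) (ppow b (x - t))%:E = (x `^ b / b)%:E)%E.
Proof.
move=> b0 /andP[x0 x1]; apply: etrans (integral_ppow b x b0 x0).
have mp : measurable_fun [set: R] (fun t => (ppow b t)%:E).
  by apply/measurable_EFinP; exact: measurable_ppow.
rewrite -(ge0_integral_reflect x (fun t => (ppow b t)%:E))//; last first.
  by move=> t; rewrite lee_fin ppow_ge0.
rewrite [LHS]integral_mkcond [RHS]integral_mkcond; apply: eq_integral => t _.
rewrite !patchE !mem_segment; case: (leP 0 t) => //= t0.
have [tx|tx] := leP t x; first by rewrite (le_trans tx).
by case: ifP => // _; rewrite /ppow ltNge subr_le0 ltW.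
Qed.

(** The substitution [x -> 1 - x] turns this into the backward integral at [1 - t]. *)
Lemma integral_ppow_forward (b t : R) : 0 < b -> 0 <= t <= 1 ->
  (\int[mu]_(x in `[0%R, 1%R]) (ppow b (x - t))%:E = ((1 - t) `^ b / b)%:E)%E.
Proof.
move=> b0 /andP[t0 t1].
have t01 : 0 <= 1 - t <= 1 by rewrite subr_ge0 t1 lerBlDr lerDl.
apply: etrans (integral_ppow_backward b (1 - t) b0 t01).
transitivity (\int[mu]_(x in `[0%R, 1%R]) (ppow b (1 - x - t))%:E)%E.
  apply/esym; apply: (ge0_integral_reflect 1 (fun x => (ppow b (x - t))%:E)).
    apply/measurable_EFinP; apply: measurableT_comp; first exact: measurable_ppow.
    exact: measurable_funB.
  by move=> x; rewrite lee_fin ppow_ge0.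
by apply: eq_integral => x _; rewrite addrAC.
Qed.

Lemma measurable_gamma_integrand (a : R) :
  measurable_fun [set: R] (fun t : R => t `^ (a - 1) * expR (- t)).
Proof.
apply: measurable_funM => //; apply: measurableT_comp => //.
Qed.

(** The integrand is at most [t^(a-1)] on []0, 1]], integrable as [a > 0], and at most the
    exponential density beyond 1, as [a <= 1]; the sum [g1 + g2] dominates it everywhere. *)
Lemma gamma_integral_lty (a : R) : 0 < a <= 1 ->
  (\int[mu]_(t in `]0%R, +oo[) (t `^ (a - 1) * expR (- t))%:E < +oo)%E.
Proof.
move=> /andP[a0 a1].
pose g1 (t : R) := if 0 <= t <= 1 then ppow a t else 0.
pose g2 := @exponential_pdf R 1.
have mg1 : measurable_fun [set: R] g1.
  apply: measurable_fun_if => //=; last first.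
    by apply: measurable_funTS; exact: measurable_ppow.
  by apply: measurable_and => //; exact: measurable_fun_ler.
have mg2 : measurable_fun [set: R] g2 by exact: measurable_exponential_pdf.
have g1_ge0 t : 0 <= g1 t by rewrite /g1; case: ifP => // _; exact: ppow_ge0.
have g2_ge0 t : 0 <= g2 t by apply: exponential_pdf_ge0.
apply: (@le_lt_trans _ _
    (\int[mu]_(t in `]0%R, +oo[) ((g1 t)%:E + (g2 t)%:E))%E).
  apply: ge0_le_integral => //.
  - by move=> t _; rewrite lee_fin mulr_ge0 ?powR_ge0 ?expR_ge0.
  - apply/measurable_EFinP; apply: measurable_funTS.
    exact: measurable_gamma_integrand.
  - by apply: emeasurable_funD; apply/measurable_EFinP/measurable_funTS.
  move=> t; rewrite /= in_itv/= andbT => t0.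
  rewrite -EFinD lee_fin /g1 /g2 (ltW t0)/=.
  rewrite exponential_pdfE ?(ltW t0)// mul1r mulN1r.
  have e0 := expR_ge0 (- t); have e1 : expR (- t) <= 1.
    by rewrite -expR0 ler_expR oppr_le0 ltW.
  have [t1|t1] := leP t 1.
    rewrite /ppow t0; have := powR_ge0 t (a - 1); nra.
  rewrite add0r ger_pMl ?expR_gt0//.
  rewrite -[leRHS](powRr0 t); apply: ler_powR; first exact: ltW.
  by rewrite subr_le0.
rewrite ge0_integralD//; last 4 first.
- by move=> t _; rewrite lee_fin.
- exact/measurable_EFinP/measurable_funTS.
- by move=> t _; rewrite lee_fin.
- exact/measurable_EFinP/measurable_funTS.
apply: lte_add_pinfty.
  apply: (@le_lt_trans _ _ (\int[mu]_t (g1 t)%:E)%E).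
    apply: ge0_subset_integral => //; first exact/measurable_EFinP.
    by move=> t _; rewrite lee_fin.
  rewrite (_ : (\int[mu]_t (g1 t)%:E)%E =
      (\int[mu]_(t in `[0%R, 1%R]) (ppow a t)%:E)%E).
    by rewrite integral_ppow// ltry.
  rewrite [RHS]integral_mkcond; apply: eq_integral => t _.
  by rewrite /g1 patchE mem_segment; case: ifP.
apply: (@le_lt_trans _ _ (\int[mu]_t (g2 t)%:E)%E).
  apply: ge0_subset_integral => //; first exact/measurable_EFinP.
  by move=> t _; rewrite lee_fin.
by rewrite integral_exponential_pdf// ltry.
Qed.

(** [fine] sends [+oo] to 0, so positivity takes finiteness of the integral as well as a lower
    bound; the latter is [exp(-1)], from the interval []0, 1]]. *)
Lemma Gamma_gt0 (a : R) : 0 < a <= 1 -> 0 < Gamma a.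
Proof.
move=> a01; have /andP[a0 a1] := a01.
rewrite /Gamma fine_gt0// gamma_integral_lty// andbT.
have h0 t : (0 <= (t `^ (a - 1) * expR (- t))%:E :> \bar R)%E.
  by rewrite lee_fin mulr_ge0 ?powR_ge0 ?expR_ge0.
have mh : measurable_fun [set: R] (fun t : R => (t `^ (a - 1) * expR (- t))%:E).
  by apply/measurable_EFinP; exact: measurable_gamma_integrand.
apply: (@lt_le_trans _ _ (\int[mu]_(t in `]0%R, 1%R]) (expR (- 1))%:E)%E).
  rewrite integral_cst//= lebesgue_measure_itv/= lte_fin ltr01 sube0 mule1.
  by rewrite lte_fin expR_gt0.
apply: (@le_trans _ _
    (\int[mu]_(t in `]0%R, 1%R]) (t `^ (a - 1) * expR (- t))%:E)%E).
  apply: ge0_le_integral => //.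
  - exact: measurable_funTS.
  move=> t; rewrite /= in_itv/= => /andP[t0 t1]; rewrite lee_fin.
  have : expR (-1) <= expR (- t) by rewrite ler_expR lerN2.
  have : 1 <= t `^ (a - 1).
    by rewrite -[leLHS](powRr0 t); apply: ger_powR; rewrite ?t0// subr_le0.
  have := expR_gt0 (- t); nra.
apply: ge0_subset_integral => //; first exact: measurable_funTS.
by apply: subset_itvl.
Qed.

End OneDim.

(** * Duality of Lp spaces *)

Lemma measurable_sgr (R : realType) : measurable_fun [set: R] (@Num.sg R).
Proof.
apply: measurable_fun_ifT => //; first exact: measurable_fun_eqr.
by apply: measurable_fun_ifT => //; exact: measurable_fun_ltr.
Qed.

Section LpDuality.
Context (d : measure_display) (T : measurableType d) (R : realType).
Variable P : probability T R.
Local Notation "'N_ p [ f ]" := (Lnorm P p (EFin \o f)).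

(** One form for finite and infinite [p]. In the infinite case [|f|] is almost everywhere below its
    essential supremum, which factors out of the integral. *)
Lemma hoelder_conjexp (p : \bar R) (f g : T -> R) : (1 < p)%E ->
  measurable_fun [set: T] f -> measurable_fun [set: T] g ->
  (\int[P]_x `|f x * g x|%:E <= 'N_p[f] * 'N_(conjexp p)[g])%E.
Proof.
case: p => [r| |]//=.
- rewrite lte_fin => r1 mf mg; rewrite gt_eqF//.
  have r0 : 0 < r by rewrite (lt_trans ltr01).
  rewrite -[leLHS]/(\int[P]_x `|(EFin \o (f \* g)%R) x|)%E -Lnorm1.
  apply: hoelder => //; first by rewrite divr_gt0// subr_gt0.
  by rewrite invf_div; field; rewrite gt_eqF.
- move=> _ mf mg; rewrite Lnorm1 unlock /= probability_setT lte01.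
  set M := ess_sup _ _.
  have M0 : (0 <= M)%E 
    by apply: ess_sup_gee; [rewrite /= probability_setT|
      apply: nearW => t; exact: abse_ge0].
  rewrite -ge0_integralZl//; last exact/measurable_EFinP/measurableT_comp.
  apply: ae_ge0_le_integral => //.
  + by apply/measurable_EFinP/measurableT_comp => //; exact: measurable_funM.
  + by move=> x _; rewrite mule_ge0//.
  + by apply: measurable_funeM; exact/measurable_EFinP/measurableT_comp.
  have := ess_sup_ge P (abse \o (EFin \o f)).
  apply: filterS => x /= fM _.
  by rewrite normrM EFinM lee_wpmul2r// lee_fin.
Qed.

(** The equality case of Hoelder, with a prescribed bound [c] on the norm of [f]. The norm is only
    bounded, not equal to [c], since [f] is zero when [g] vanishes almost everywhere. *)
Lemma Lnorm_attained (p : \bar R) (g : T -> R) (c : R) : (1 < p)%E -> 0 <= c ->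
  g \in Lfun P (conjexp p) ->
  exists f : T -> R, [/\ measurable_fun [set: T] f, ('N_p[f] <= c%:E)%E &
    \int[P]_x (f x * g x)%:E = c%:E * 'N_(conjexp p)[g] ]%E.
Proof.
case: p => [r| |]//=.
- rewrite lte_fin => r1 c0; rewrite gt_eqF//; set s := r / (r - 1) => gL.
  have r0 : 0 < r by rewrite (lt_trans ltr01).
  have rB1 : 0 < r - 1 by rewrite subr_gt0.
  have s0 : 0 < s by rewrite divr_gt0.
  have s1E : s - 1 = (r - 1)^-1 by rewrite /s; field; rewrite gt_eqF.
  have s1 : 1 <= s by rewrite -subr_ge0 s1E invr_ge0 ltW.
  have sr : (s - 1) * r = s by rewrite s1E mulrC.
  have sV : s^-1 = 1 - r^-1 by rewrite /s; field; rewrite ?gt_eqF.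
  have mg : measurable_fun [set: T] g by case/andP: gL => /[!inE].
  have ig := Lfun_integrable s1 gL.
  have mgs : measurable_fun [set: T] (fun x => (`|g x| `^ s)%:E).
    by case/integrableP: ig.
  pose B := fine (\int[P]_x (`|g x| `^ s)%:E).
  have BE : (\int[P]_x (`|g x| `^ s)%:E = B%:E)%E.
    by rewrite fineK//; exact: integrable_fin_num.
  have B0 : 0 <= B.
    by rewrite fine_ge0// integral_ge0// => x _; rewrite lee_fin powR_ge0.
  have NE : 'N_s%:E[g] = (B `^ s^-1)%:E.
    by rewrite unlock -poweR_EFin -BE.
  (* Since [(s - 1) * r = s], the power [|f|^r] is a multiple of [|g|^s], and the factor in [B]
     normalises its integral. For [B = 0] that factor is 0 by the convention for [powR]. *)
  pose f x := c * B `^ (- r^-1) * (Num.sg (g x) * `|g x| `^ (s - 1)).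
  have mf : measurable_fun [set: T] f.
    apply: measurable_funM => //; apply: measurable_funM.
      by apply: measurableT_comp => //; exact: measurable_sgr.
    apply: (measurableT_comp (measurable_powR _)); exact: measurableT_comp.
  have sg0 x : `|Num.sg (g x)| * `|g x| `^ (s - 1) = `|g x| `^ (s - 1).
    rewrite normr_sg; have [->|gx0] := eqVneq (g x) 0; last by rewrite mul1r.
    by rewrite mul0r normr0 powR0// s1E invr_eq0 gt_eqF.
  exists f; split => //.
  + rewrite unlock.
    have E x : ((`|f x| `^ r)%:E =
        (c `^ r * (B `^ (- r^-1)) `^ r)%:E * (`|g x| `^ s)%:E)%E.
      rewrite /f !normrM (ger0_norm c0) (ger0_norm (powR_ge0 _ _)).
      rewrite (ger0_norm (powR_ge0 `|g x| _)) sg0 -EFinM.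
      by rewrite powRM ?mulr_ge0 ?powR_ge0// powRM ?powR_ge0//
        -[(`|g x| `^ _) `^ r]powRrM sr.
    under eq_integral do rewrite /= E.
    rewrite ge0_integralZl//; last first.
      by rewrite lee_fin mulr_ge0 ?powR_ge0.
    rewrite BE -EFinM poweR_EFin lee_fin.
    have cE : (c `^ r) `^ r^-1 = c by rewrite -powRrM divff ?gt_eqF// powRr1.
    rewrite -[leRHS]cE.
    apply: ge0_ler_powR; rewrite ?invr_ge0 ?nnegrE ?mulr_ge0 ?powR_ge0 ?(ltW r0)//.
    rewrite -[leRHS]mulr1 -!mulrA; apply: ler_wpM2l; first exact: powR_ge0.
    rewrite -[X in X * _]powRrM mulNr mulVf ?gt_eqF// powRN powRr1//.
    have [->|Bn0] := eqVneq B 0; first by rewrite mulr0.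
    by rewrite mulVf.
  + have E x : ((f x * g x)%:E = (c * B `^ (- r^-1))%:E * (`|g x| `^ s)%:E)%E.
      rewrite -EFinM /f -!mulrA; congr (_ * (_ * _))%:E.
      by rewrite mulrCA -normrEsg mulrC mulr_powRB1.
    under eq_integral do rewrite E.
    rewrite ge0_integralZl//; last first.
      by rewrite lee_fin mulr_ge0 ?powR_ge0.
    rewrite BE NE -!EFinM; congr EFin; rewrite -mulrA; congr (_ * _).
    have [->|Bn0] := eqVneq B 0.
      by rewrite mulr0 powR0// invr_eq0 gt_eqF.
    rewrite sV powRB ?Bn0 ?implybT// powRr1// powRN mulrC//.
- move=> _ c0 gL.
  have mg : measurable_fun [set: T] g by case/andP: gL => /[!inE].
  exists (fun x => c * Num.sg (g x)); split.
  + by apply: measurable_funM => //; apply: measurableT_comp => //; exact: measurable_sgr.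
  + rewrite unlock /= probability_setT lte01; apply/ess_supP; apply: nearW => x /=.
    rewrite lee_fin normrM (ger0_norm c0) normr_sg.
    by case: (g x == 0); rewrite ?mulr0// mulr1.
  + rewrite Lnorm1 -ge0_integralZl//; last exact/measurable_EFinP/measurableT_comp.
    apply: eq_integral => x _ /=.
    by rewrite -EFinM -mulrA -normrEsg.
Qed.

End LpDuality.

(** * The kernel *)

Lemma powR_prod (R : realType) (I : Type) (l : seq I) (F : I -> R) (r : R) :
  (forall i, 0 <= F i) ->
  (\prod_(i <- l) F i) `^ r = \prod_(i <- l) (F i `^ r).
Proof.
move=> F0; elim: l => [|i l IH]; first by rewrite !big_nil powR1.
by rewrite !big_cons powRM ?prodr_ge0// IH.
Qed.

Section Kernel.
Context {R : realType}.

Lemma eq_Lpn k (p : \bar R) (f g : k.-tuple R -> R) :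
  (forall t, cube k t -> f t = g t) -> Lpn k p f = Lpn k p g.
Proof.
move=> fg; case: p => [r| |]; last by [].
  rewrite /Lpn !integral_lebn_cube; congr (_ `^ _)%E.
  by apply: eq_integral => t; rewrite inE => ct; rewrite fg.
rewrite /Lpn; congr ereal_inf; apply/funext => M /=.
rewrite (_ : cube k `&` [set t | (M < `|f t|%:E)%E] =
             cube k `&` [set t | (M < `|g t|%:E)%E])//.
by apply/seteqP; split=> t [ct /= h]; split => //=; [rewrite -fg|rewrite fg].
Qed.

(** For [p = +oo] both sides are infima over the same set of [M], by [lebn_cubeI]. *)
Lemma Lpn_Lnorm k (p : \bar R) (f : k.-tuple R -> R) : (0 < p)%E ->
  measurable_fun [set: k.-tuple R] f ->
  Lpn k p f = Lnorm (cube_prob k) p (EFin \o f).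
Proof.
move=> p0 mf; have mnf : measurable_fun [set: k.-tuple R] (fun t => `|f t|%:E).
  exact/measurable_EFinP/measurableT_comp.
rewrite unlock; case: p p0 => [r r0| _|]//=.
  rewrite integral_lebn//; apply/measurable_EFinP.
  by apply: (measurableT_comp (measurable_powR _)); exact: measurableT_comp.
rewrite probability_setT lte01 ess_supEmu0//; congr ereal_inf.
apply/funext => M /=.
have mA : measurable [set t | (M < `|f t|%:E)%E].
  by rewrite -[X in measurable X]setTI; apply: emeasurable_fun_o_infty.
rewrite setIC lebn_cubeI//; congr (cube_prob k _ = _).
by apply/seteqP; split=> t /=; rewrite in_itv/= ?andbT.
Qed.

Lemma integral_cube_prob k (f : k.-tuple R -> \bar R) :
  measurable_fun [set: k.-tuple R] f ->
  (\int[cube_prob k]_t f t = \int[cube_prob k]_(t in cube k) f t)%E.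
Proof. by move=> mf; rewrite -integral_lebn// integral_lebn_cube. Qed.

Variables (s : nat) (u : {set 'I_s}).
Local Notation k := #|u|.
Implicit Types (a r : R) (x : s.-tuple R) (t : k.-tuple R).

Lemma kern_ge0 a x t : 0 <= kern s a u x t.
Proof. by apply: prodr_ge0 => i _; exact: ppow_ge0. Qed.

Lemma measurable_kern2 a : measurable_fun [set: s.-tuple R * k.-tuple R]
  (fun z => kern s a u z.1 z.2).
Proof.
rewrite /kern; apply: measurable_prod => i _.
apply: (measurableT_comp (measurable_ppow a)).
apply: measurable_funB.
  exact: (measurableT_comp (@measurable_tnth _ R s (enum_val i)) measurable_fst).
exact: (measurableT_comp (@measurable_tnth _ R k i) measurable_snd).
Qed.

Lemma measurable_kern a x : measurable_fun [set: k.-tuple R] (kern s a u x).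
Proof.
rewrite /kern; apply: measurable_prod => i _.
apply: (measurableT_comp (measurable_ppow a)).
by apply: measurable_funB => //; exact: measurable_tnth.
Qed.

(** Reduces L_r norms of the kernel to integrals of a kernel of another order. The case [r = 0]
    fails where [ppow] is 0, because zero to the power zero is one. *)
Lemma powR_ppow a r (y : R) : r != 0 -> (ppow a y) `^ r = ppow (r * (a - 1) + 1) y.
Proof.
move=> r0; rewrite /ppow; case: ifP => _; last by rewrite powR0.
by rewrite addrK mulrC powRrM.
Qed.

Lemma powR_kern a r x t : r != 0 ->
  (kern s a u x t) `^ r = kern s (r * (a - 1) + 1) u x t.
Proof.
move=> r0; rewrite /kern powR_prod; last by move=> i; exact: ppow_ge0.
by apply: eq_bigr => i _; exact: powR_ppow.
Qed.

Lemma integral_kern_backward a x : 0 < a -> cube s x ->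
  (\int[cube_prob k]_t (kern s a u x t)%:E =
   (\prod_(i < k) (tnth x (enum_val i) `^ a / a))%:E)%E.
Proof.
move=> a0 cx.
rewrite (integral_cube_prob_prod k (fun i y => ppow a (tnth x (enum_val i) - y))).
- rewrite -prodEFin; apply: eq_bigr => i _; exact: integral_ppow_backward.
- move=> i; apply: measurableT_comp; first exact: measurable_ppow.
  exact: measurable_funB.
- by move=> i y; exact: ppow_ge0.
Qed.

Lemma integral_kern_forward a t : 0 < a -> cube k t ->
  (\int[cube_prob s]_x (kern s a u x t)%:E =
   (\prod_(i < k) ((1 - tnth t i) `^ a / a))%:E)%E.
Proof.
move=> a0 ct.
(* Regroups the product over [u] as a product over all [s] coordinates: [g j] is a single factor for
   [j] in [u] and the empty product, with integral 1, otherwise. *)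
pose g j (y : R) := \prod_(i < k | enum_val i == j) ppow a (y - tnth t i).
transitivity (\int[cube_prob s]_x (\prod_(j < s) g j (tnth x j))%:E)%E.
  apply: eq_integral => x _; congr EFin; rewrite /kern.
  rewrite (partition_big (fun i : 'I_k => enum_val i) predT)//=.
  by apply: eq_bigr => j _; apply: eq_bigr => i /eqP <-.
rewrite integral_cube_prob_prod; last 2 first.
- move=> j; rewrite /g; under eq_fun do rewrite big_mkcond/=.
  apply: measurable_prod => i _; case: (enum_val i == j) => //.
  by apply: (measurableT_comp (measurable_ppow a)); exact: measurable_funB.
- by move=> j y; apply: prodr_ge0 => i _; exact: ppow_ge0.
rewrite (partition_big (fun i : 'I_k => enum_val i) predT)//= -prodEFin.
apply: eq_bigr => j _; have [ju|ju] := boolP (j \in u).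
  have ej (i : 'I_k) : (enum_val i == j) = (i == enum_rank_in ju j).
    by rewrite -(inj_eq enum_val_inj) enum_rankK_in.
  rewrite (big_pred1 _ ej).
  under eq_integral do rewrite /g (big_pred1 _ ej).
  exact: integral_ppow_forward.
have ej (i : 'I_k) : (enum_val i == j) = false.
  by apply: contraNF ju => /eqP <-; exact: enum_valP.
rewrite big_pred0//; under eq_integral do rewrite /g big_pred0//.
by rewrite integral_cst//= mul1e lebesgue_measure_itv/= lte_fin ltr01 sube0.
Qed.

End Kernel.

Section DualPairing.
Context (d : measure_display) (T : measurableType d) (R : realType).
Variable P : probability T R.

Lemma integrable_dual_pairing (p : \bar R) (f g : T -> R) : (1 < p)%E ->
  measurable_fun [set: T] f -> (Lnorm P p (EFin \o f) < +oo)%E ->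
  g \in Lfun P (conjexp p) -> P.-integrable [set: T] (fun x => (f x * g x)%:E).
Proof.
move=> p1 mf fp /andP[/[!inE]/= mg gp]; apply/integrableP; split.
  exact/measurable_EFinP/measurable_funM.
apply: le_lt_trans (hoelder_conjexp _ _ _ P _ _ _ p1 mf mg) _.
by apply: lte_mul_pinfty; rewrite ?Lnorm_ge0// ge0_fin_numE// Lnorm_ge0.
Qed.

End DualPairing.

(** * Integrability of the kernel and Fubini's theorem *)

Section KernelLp.
Context {R : realType}.
Variables (s : nat) (u : {set 'I_s}).
Local Notation k := #|u|.

(** The place where [p > 1 / a] becomes positivity of the order of the powered kernel. The conjugate
    exponent is always finite here, as [p > 1]; for [p = +oo] it is 1 and the order stays [a]. *)
Lemma conjexp_bounds (a : R) (p : \bar R) : 0 < a <= 1 -> (a^-1%:E < p)%E ->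
  exists r, [/\ conjexp p = r%:E, 1 <= r & 0 < r * (a - 1) + 1].
Proof.
move=> /andP[a0 a1]; case: p => [r| |]//=; last first.
  by move=> _; exists 1; split => //; rewrite mul1r subrK.
rewrite lte_fin => ar.
have r1 : 1 < r by rewrite (le_lt_trans _ ar)// invf_ge1.
have rB : 0 < r - 1 by rewrite subr_gt0.
have ra : 1 < r * a by rewrite -ltr_pdivrMr// div1r.
rewrite gt_eqF//; exists (r / (r - 1)); split => //.
  by rewrite ler_pdivlMr// mul1r gerBl.
have -> : r / (r - 1) * (a - 1) + 1 = (r * a - 1) / (r - 1).
  by field; rewrite gt_eqF.
by rewrite divr_gt0// subr_gt0.
Qed.

Lemma kern_Lfun (a r : R) (x : s.-tuple R) : 1 <= r -> 0 < r * (a - 1) + 1 ->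
  cube s x -> kern s a u x \in Lfun (cube_prob k) r%:E.
Proof.
move=> r1 b0 cx; rewrite inE; apply/andP; split; rewrite inE/=.
  exact: measurable_kern.
have r0 : r != 0 by rewrite gt_eqF// (lt_le_trans ltr01).
rewrite /finite_norm unlock; apply: poweR_lty => /=.
under eq_integral do rewrite ger0_norm ?kern_ge0// powR_kern//.
by rewrite integral_kern_backward// ltry.
Qed.

Lemma measurable_kern1 (b : R) (t : k.-tuple R) :
  measurable_fun [set: s.-tuple R] (fun x => kern s b u x t).
Proof.
rewrite /kern; apply: measurable_prod => i _.
apply: (measurableT_comp (measurable_ppow b)).
by apply: measurable_funB => //; exact: measurable_tnth.
Qed.

(* On the cube [(1 - t)^alpha] is the kernel of order [alpha + 1] at the point
   [(1,...,1)], so the integral of the kernel over [x] is again a kernel. *)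
Definition ones : s.-tuple R := [tuple of nseq s 1].

Lemma cube_ones : cube s ones.
Proof. by move=> i; rewrite tnth_nseq ler01 lexx. Qed.

Lemma kern_ones (a : R) (t : k.-tuple R) : 0 < a -> cube k t ->
  kern s (a + 1) u ones t = \prod_(i < k) ((1 - tnth t i) `^ a).
Proof.
move=> a0 ct; apply: eq_bigr => i _; rewrite /ppow tnth_nseq addrK.
(* At [t_i = 1] the truncated power is 0 by definition, and so is the [a]-th power of 0, as
   [a > 0]. *)
have /andP[_] := ct i; rewrite -subr_ge0 le_eqVlt => /predU1P[<-|->//].
by rewrite ltxx powR0// gt_eqF.
Qed.

Lemma integral_kern_ones (a : R) (t : k.-tuple R) : 0 < a -> cube k t ->
  (\int[cube_prob s]_x (kern s a u x t)%:E =
   (a ^- k * kern s (a + 1) u ones t)%:E)%E.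
Proof.
move=> a0 ct; rewrite integral_kern_forward// kern_ones//.
by rewrite big_split/= prodr_const card_ord mulrC exprVn.
Qed.

Variables (a : R) (p : \bar R).
Hypotheses (a01 : 0 < a <= 1) (ap : (a^-1%:E < p)%E).

Let a0 : 0 < a. Proof. by case/andP: a01. Qed.

Lemma gt1_exponent : (1 < p)%E.
Proof.
case/andP: a01 => _ a1; apply: le_lt_trans ap.
by rewrite lee_fin invf_ge1.
Qed.

Lemma kern_Lfun_conjexp (x : s.-tuple R) : cube s x ->
  kern s a u x \in Lfun (cube_prob k) (conjexp p).
Proof.
by move=> cx; have [r [-> r1 b0]] := conjexp_bounds _ _ a01 ap; exact: kern_Lfun.
Qed.

Lemma kern_ones_Lfun_conjexp (c : R) :
  (fun t => c * kern s (a + 1) u ones t) \in Lfun (cube_prob k) (conjexp p).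
Proof.
have [r [-> r1 b0]] := conjexp_bounds _ _ a01 ap.
rewrite (_ : (fun t => _) = c \o* kern s (a + 1) u ones).
  apply: Lfun_scale => //; apply: kern_Lfun => //; last exact: cube_ones.
  by rewrite addrK ltr_wpDl// mulr_ge0 ?(ltW a0)// (le_trans ler01).
by apply/funext => t /=; rewrite mulrC.
Qed.

Section Fubini.
Variable F : k.-tuple R -> R.
Hypotheses (mF : measurable_fun [set: k.-tuple R] F)
  (Fp : (Lnorm (cube_prob k) p (EFin \o F) < +oo)%E).

Let H (z : s.-tuple R * k.-tuple R) : \bar R := (F z.2 * kern s a u z.1 z.2)%:E.

Let mH : measurable_fun [set: s.-tuple R * k.-tuple R] H.
Proof.
apply/measurable_EFinP; apply: measurable_funM; last exact: measurable_kern2.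
exact: measurableT_comp.
Qed.

(** By Tonelli with [x] innermost: the kernel is nonnegative and its [x]-integral is explicit, which
    leaves [|F|] times a function in L_p', integrable by Hoelder. *)
Let integrableH : (cube_prob s \x cube_prob k)%E.-integrable setT H.
Proof.
apply/integrable21ltyP => //.
have mG : measurable_fun [set: k.-tuple R]
    (fun t => (\int[cube_prob s]_x `|H (x, t)|)%E).
  apply: (@measurable_fun_fubini_tonelli_G _ _ _ _ _ _ (fun z => `|H z|%E)) => //.
  exact: measurableT_comp.
rewrite integral_cube_prob//.
rewrite (eq_integral (fun t => `|F t * (a ^- k * kern s (a + 1) u ones t)|%:E)).
  rewrite -integral_cube_prob.
    have /integrableP[_] := integrable_dual_pairing _ _ _ _ _ _ _ gt1_exponent mF Fp
      (kern_ones_Lfun_conjexp (a ^- k)).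
    exact.
  apply/measurable_EFinP/measurableT_comp => //; apply: measurable_funM => //.
  by apply: measurable_funM => //; exact: measurable_kern.
move=> t; rewrite inE => ct.
rewrite normrM EFinM [X in (_ * X%:E)%E]ger0_norm; last first.
  by rewrite mulr_ge0 ?kern_ge0// invr_ge0 exprn_ge0// ltW.
rewrite -integral_kern_ones// -ge0_integralZl//.
- apply: eq_integral => x _; rewrite /H abse_EFin normrM.
  by rewrite (ger0_norm (kern_ge0 _ _ _ _ _)).
- by apply/measurable_EFinP; exact: measurable_kern1.
- by move=> x _; rewrite lee_fin kern_ge0.
Qed.

Lemma integrable_kern_transform :
  (cube_prob s).-integrable setT
    (fun x => \int[cube_prob k]_t (F t * kern s a u x t)%:E)%E.
Proof. exact: (@integrable_fubini_F _ _ _ _ _ _ _ _ integrableH). Qed.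

Lemma integral_kern_transform :
  (\int[cube_prob s]_x \int[cube_prob k]_t (F t * kern s a u x t)%:E =
   \int[cube_prob k]_t (F t * (a ^- k * kern s (a + 1) u ones t))%:E)%E.
Proof.
rewrite (Fubini integrableH).
rewrite [LHS]integral_cube_prob; last first.
  exact: (@measurable_fubini_G _ _ _ _ _ _ _ _ integrableH).
rewrite [RHS]integral_cube_prob; last first.
  apply/measurable_EFinP; apply: measurable_funM => //.
  by apply: measurable_funM => //; exact: measurable_kern.
apply: eq_integral => t; rewrite inE => ct.
rewrite EFinM -integral_kern_ones// -integralZl//.
apply/integrableP; split; first by apply/measurable_EFinP; exact: measurable_kern1.
under eq_integral do rewrite abse_EFin ger0_norm ?kern_ge0//.
by rewrite integral_kern_ones// ltry.
Qed.

End Fubini.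
End KernelLp.

(** * The integration error *)

Section ErrorFormula.
Context {R : realType}.
Variables (s N : nat) (a : R) (p : \bar R) (X : 'I_N -> s.-tuple R).
Hypotheses (a01 : 0 < a <= 1) (ap : (a^-1%:E < p)%E).
Hypothesis cX : forall n, cube s (X n).

(** [Delta] with its first product written as a kernel at [ones]. As a linear combination of kernels
    it inherits their measurability and L_p' membership, and it agrees with [Delta] on the cube,
    which is all that [Lpn] sees. *)
Definition Delta_kern (u : {set 'I_s}) (t : #|u|.-tuple R) : R :=
  a ^- #|u| * kern s (a + 1) u (ones s) t
  - N%:R^-1 * \sum_(n < N) kern s a u (X n) t.

Lemma Delta_kernE (u : {set 'I_s}) t :
  cube #|u| t -> Delta s a u N X t = Delta_kern u t.
Proof. by move=> ct; rewrite /Delta /Delta_kern kern_ones//; case/andP: a01. Qed.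

Lemma measurable_Delta_kern (u : {set 'I_s}) :
  measurable_fun [set: #|u|.-tuple R] (Delta_kern u).
Proof.
apply: measurable_funB; apply: measurable_funM => //; first exact: measurable_kern.
by apply: measurable_sum => n; exact: measurable_kern.
Qed.

Lemma Delta_kern_Lfun (u : {set 'I_s}) :
  Delta_kern u \in Lfun (cube_prob #|u|) (conjexp p).
Proof.
have p1 : (1 <= conjexp p)%E.
  by have [r [-> r1 _]] := conjexp_bounds _ _ a01 ap; rewrite lee_fin.
have [L0 LD] := Lfun_addr_closed (cube_prob #|u|) p1.
pose K n (t : #|u|.-tuple R) := - N%:R^-1 * kern s a u (X n) t.
rewrite (_ : Delta_kern u = (fun t => a ^- #|u| * kern s (a + 1) u (ones s) t) +
    \sum_(n < N) K n).
  apply: (@LD _ _); first exact: kern_ones_Lfun_conjexp.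
  apply: (big_ind (fun f => f \in Lfun (cube_prob #|u|) (conjexp p))) => [|f g|n _].
  - exact: L0.
  - exact: LD.
  have [r [rE r1 _]] := conjexp_bounds _ _ a01 ap.
  rewrite rE (_ : K n = (- N%:R^-1) \o* kern s a u (X n)).
    by apply: Lfun_scale => //; rewrite -rE; exact: kern_Lfun_conjexp.
  by apply/funext => t; rewrite /K/= mulrC.
apply/funext => t; rewrite /Delta_kern [RHS]/GRing.add/=; congr (_ + _).
by rewrite fct_sumE -mulr_sumr mulNr.
Qed.

Section Family.
Variables (F : @Defs.family R s) (f : s.-tuple R -> R).
Hypothesis mF : forall u : {set 'I_s},
  measurable_fun [set: #|u|.-tuple R] (F u).
Hypothesis Fp : forall u : {set 'I_s},
  (Lnorm (cube_prob #|u|) p (EFin \o F u) < +oo)%E.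
Hypothesis Ff : represents s a F f.

Let c (u : {set 'I_s}) := (Gamma a)^-1 ^+ #|u|.
Let p1 := gt1_exponent _ _ a01 ap.

Let kern_transform (u : {set 'I_s}) x :=
  (\int[cube_prob #|u|]_t (F u t * kern s a u x t)%:E)%E.

Let representsE x : cube s x ->
  ((f x)%:E = \sum_(u : {set 'I_s}) (c u)%:E * kern_transform u x)%E.
Proof.
move=> cx; rewrite Ff//; apply: eq_bigr => u _; congr (_ * _)%E.
rewrite integral_lebn//; apply/measurable_EFinP; apply: measurable_funM.
  exact: mF.
exact: measurable_kern.
Qed.

Let integrable_kern (u : {set 'I_s}) x : cube s x ->
  (cube_prob #|u|).-integrable setT (fun t => (F u t * kern s a u x t)%:E).
Proof.
move=> cx; exact: (integrable_dual_pairing _ _ _ _ _ _ _ p1 (mF u) (Fp u)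
  (kern_Lfun_conjexp _ _ _ _ a01 ap _ cx)).
Qed.

Let integrable_ones (u : {set 'I_s}) : (cube_prob #|u|).-integrable setT
  (fun t => (F u t * (a ^- #|u| * kern s (a + 1) u (ones s) t))%:E).
Proof.
exact: (integrable_dual_pairing _ _ _ _ _ _ _ p1 (mF u) (Fp u)
  (kern_ones_Lfun_conjexp _ _ _ _ a01 ap _)).
Qed.

(** All integrals involved are finite; naming their real values lets the sums be rearranged in [R]
    instead of the extended reals. *)
Let v (u : {set 'I_s}) n := fine (kern_transform u (X n)).
Let w (u : {set 'I_s}) := fine (\int[cube_prob #|u|]_t
  (F u t * (a ^- #|u| * kern s (a + 1) u (ones s) t))%:E).

Let vE (u : {set 'I_s}) n : kern_transform u (X n) = (v u n)%:E.
Proof. by rewrite /v fineK//; apply: integrable_fin_num => //; exact: integrable_kern. Qed.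

Let wE (u : {set 'I_s}) : (\int[cube_prob #|u|]_t
  (F u t * (a ^- #|u| * kern s (a + 1) u (ones s) t))%:E = (w u)%:E)%E.
Proof. by rewrite /w fineK//; exact: integrable_fin_num. Qed.

Let integral_f :
  (\int[lebn s]_(x in cube s) (f x)%:E = (\sum_(u : {set 'I_s}) c u * w u)%:E)%E.
Proof.
rewrite integral_lebn_cube.
have ikt (u : {set 'I_s}) : (cube_prob s).-integrable setT (kern_transform u).
  exact: (integrable_kern_transform _ _ _ _ a01 ap _ (mF u) (Fp u)).
have ict (u : {set 'I_s}) : (cube_prob s).-integrable setT
    (fun x => (c u)%:E * kern_transform u x)%E.
  exact: integrableZl.
rewrite (eq_integral (fun x =>
    \sum_(u : {set 'I_s}) (c u)%:E * kern_transform u x)%E); last first.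
  by move=> x; rewrite inE => cx; exact: representsE.
rewrite -integral_cube_prob; last first.
  by apply: emeasurable_sum => u; have /integrableP[] := ict u.
rewrite integral_sum// -sumEFin; apply: eq_bigr => u _.
rewrite integralZl// EFinM; congr (_ * _)%E.
by rewrite -wE; exact: (integral_kern_transform _ _ _ _ a01 ap _ (mF u) (Fp u)).
Qed.

Let QP_f : QP s N X f =
  \sum_(u : {set 'I_s}) c u * (N%:R^-1 * \sum_(n < N) v u n).
Proof.
have fX n : f (X n) = \sum_(u : {set 'I_s}) c u * v u n.
  apply: EFin_inj; rewrite representsE// -sumEFin.
  by apply: eq_bigr => u _; rewrite vE.
rewrite /QP; under eq_bigr do rewrite fX.
rewrite exchange_big/= mulr_sumr; apply: eq_bigr => u _.
by rewrite -mulr_sumr mulrCA.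
Qed.

Let integral_Delta (u : {set 'I_s}) :
  (\int[cube_prob #|u|]_t (F u t * Delta_kern u t)%:E =
  (w u - N%:R^-1 * \sum_(n < N) v u n)%:E)%E.
Proof.
have iK (n : 'I_N) : (cube_prob #|u|).-integrable setT
    (fun t => (N%:R^-1)%:E * (F u t * kern s a u (X n) t)%:E)%E.
  by apply: integrableZl => //; exact: integrable_kern.
rewrite (eq_integral (fun t =>
    (F u t * (a ^- #|u| * kern s (a + 1) u (ones s) t))%:E
    - \sum_(n < N) (N%:R^-1)%:E * (F u t * kern s a u (X n) t)%:E)%E); last first.
  move=> t _; under eq_bigr do rewrite -EFinM.
  rewrite sumEFin -EFinB /Delta_kern mulrBr -mulr_sumr -mulr_sumr.
  by rewrite [N%:R^-1 * (F u t * _)]mulrCA.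
rewrite integralB//; last 2 first.
- exact: integrable_ones.
- exact: integrable_sum.
rewrite wE integral_sum// EFinB; congr (_ - _)%E.
rewrite mulr_sumr -sumEFin; apply: eq_bigr => n _.
by rewrite integralZl ?EFinM -?vE//; exact: integrable_kern.
Qed.

Lemma error_formula :
  (\int[lebn s]_(x in cube s) (f x)%:E - (QP s N X f)%:E =
   \sum_(u : {set 'I_s}) (((Gamma a)^-1 ^+ #|u|)%:E *
     \int[cube_prob #|u|]_t (F u t * Delta_kern u t)%:E))%E.
Proof.
rewrite integral_f QP_f -EFinB -sumrB -sumEFin; apply: eq_bigr => u _.
by rewrite -mulrBr EFinM integral_Delta.
Qed.

End Family.
End ErrorFormula.

(** * Duality of lq sums *)

Section DiscreteDuality.
Context {R : realType} {I : finType}.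
Variable P : pred I.
Implicit Types (a b : I -> R) (q : \bar R).

Lemma lqsum_fin (r : R) (Q : pred I) a : (forall i, 0 <= a i) ->
  lqsum r%:E Q (EFin \o a) = ((\sum_(i | Q i) a i `^ r) `^ r^-1)%:E.
Proof. by move=> a0; rewrite /= -poweR_EFin -sumEFin. Qed.

Lemma le_lqsum q (a b : I -> \bar R) : (0 < q)%E ->
  (forall i, 0 <= a i)%E -> (forall i, a i <= b i)%E ->
  (lqsum q predT a <= lqsum q predT b)%E.
Proof.
case: q => [r| |]//; rewrite ?lte_fin => r0 a0 ab /=.
  have b0 i : (0 <= b i)%E by exact: le_trans (ab i).
  have pw0 (x : I -> \bar R) : (0 <= \sum_i x i `^ r)%E.
    by apply: sume_ge0 => i _; exact: poweR_ge0.
  apply: gt0_ler_poweR; rewrite ?invr_ge0 ?(ltW r0) ?in_itv/= ?leey ?pw0//.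
  apply: lee_sum => i _; apply: gt0_ler_poweR;
    rewrite ?(ltW r0) ?in_itv/= ?leey ?a0 ?b0//.
by apply: le_bigmax2 => i _; exact: ab.
Qed.

(** The norm of [a] runs over all indices and that of [b] over [P] only: this fits a function norm
    that counts the empty set and a discrepancy that omits it. *)
Lemma lqsum_hoelder q a b : (1 <= q)%E ->
  (forall i, 0 <= a i) -> (forall i, 0 <= b i) ->
  (lqsum q predT (EFin \o a) <= 1)%E ->
  ((\sum_(i | P i) a i * b i)%:E <= lqsum (conjexp q) P (EFin \o b))%E.
Proof.
case: q => [r| |]//.
- rewrite lee_fin le_eqVlt => /predU1P[<-|r1] a0 b0.
    rewrite lqsum_fin// [conjexp _]/= eqxx lee_fin invr1.
    under eq_bigr do rewrite powRr1//.
    rewrite powRr1 ?sumr_ge0//= => a1.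
    set M := (\big[maxe/0%E]_(i | P i) (b i)%:E)%E.
    have M0 : (0 <= M)%E by exact: bigmax_ge_id.
    have bM i : P i -> ((b i)%:E <= M)%E.
      by move=> Pi; exact: (le_bigmax_cond _ (EFin \o b)).
    rewrite -sumEFin.
    apply: (@le_trans _ _ (\sum_(i | P i) (a i)%:E * M)%E).
      by apply: lee_sum => i Pi; rewrite EFinM lee_wpmul2l ?lee_fin ?bM.
    rewrite -ge0_sume_distrl; last by move=> i _; rewrite lee_fin.
    rewrite sumEFin -[leRHS]mul1e lee_wpmul2r// lee_fin (le_trans _ a1)//.
    by rewrite big_mkcond/=; apply: ler_sum => i _; case: ifP.
  have r0 : 0 < r by rewrite (lt_trans ltr01).
  have rB : 0 < r - 1 by rewrite subr_gt0.
  rewrite lqsum_fin// [conjexp _]/= gt_eqF//; set t := r / (r - 1).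
  have t0 : 0 < t by rewrite divr_gt0.
  rewrite lqsum_fin// !lee_fin => a1.
  have {}a1 : \sum_i a i `^ r <= 1.
    have S0 : 0 <= \sum_i a i `^ r by apply: sumr_ge0 => i _; exact: powR_ge0.
    have : ((\sum_i a i `^ r) `^ r^-1) `^ r <= 1 `^ r.
      by apply: ge0_ler_powR; rewrite ?nnegrE ?powR_ge0 ?(ltW r0).
    by rewrite -powRrM mulVf ?gt_eqF// powRr1// powR1.
  set S := \sum_(i | P i) b i `^ t; set B := S `^ t^-1.
  have S0 : 0 <= S by apply: sumr_ge0 => i _; exact: powR_ge0.
  (* The normalisation below divides by [B]; when [S = 0] every [b i] with [P i] is 0. *)
  have [Sz|Sn0] := eqVneq S 0.
    rewrite (_ : \sum_(i | P i) a i * b i = 0) ?powR_ge0//.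
    apply: big1 => i Pi; move/eqP: Sz; rewrite psumr_eq0; last first.
      by move=> j _; exact: powR_ge0.
    move=> /allP/(_ i); rewrite mem_index_enum Pi => /(_ isT)/eqP/powR_eq0_eq0 ->.
    by rewrite mulr0.
  have Sgt0 : 0 < S by rewrite lt_neqAle eq_sym Sn0.
  have B0 : 0 < B by rewrite powR_gt0.
  rewrite -[leRHS]mul1r -ler_pdivrMr// mulr_suml.
  (* Young's inequality for [a i] and [b i / B]. After the scaling by [B] the two sums are at most
     [1 / r] and exactly [1 / t]. *)
  apply: (@le_trans _ _ (\sum_(i | P i) (a i `^ r / r + (b i / B) `^ t / t))).
    apply: ler_sum => i _; rewrite -mulrA; apply: conjugate_powR => //.
      by rewrite divr_ge0// ltW.
    by rewrite /t invf_div; field; rewrite gt_eqF.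
  rewrite big_split/= -!mulr_suml.
  have -> : \sum_(i | P i) (b i / B) `^ t = 1.
    under eq_bigr do rewrite powRM ?invr_ge0 ?(ltW B0)//.
    rewrite -mulr_suml -/S -(powR_inv1 (ltW B0)) powRAC.
    have -> : B `^ t = S by rewrite -powRrM mulVf ?gt_eqF// powRr1.
    by rewrite powR_inv1// mulfV.
  have : \sum_(i | P i) a i `^ r <= 1.
    apply: le_trans a1; rewrite big_mkcond/=; apply: ler_sum => i _.
    by case: ifP => // _; exact: powR_ge0.
  rewrite -(ler_pM2r (x := r^-1)) ?invr_gt0// => h.
  apply: le_trans (lerD h (lexx _)) _; rewrite /t.
  by rewrite le_eqVlt; apply/orP; left; apply/eqP; field; rewrite !gt_eqF.
- move=> _ a0 b0 a1; rewrite [conjexp _]/= lqsum_fin// invr1 powRr1; last first.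
    by apply: sumr_ge0 => i _; exact: powR_ge0.
  have {}a1 i : a i <= 1.
    rewrite -lee_fin; apply: le_trans a1.
    exact: (@le_bigmax_cond _ _ _ _ _ predT (EFin \o a)).
  rewrite lee_fin; apply: ler_sum => i _.
  by rewrite powRr1// ler_piMl.
Qed.

(** The extremal [a] is a unit mass at a maximum of [b] for [q = 1], a multiple of [b^(t-1)] for
    finite [q > 1], and constantly 1 for [q = +oo]. *)
Lemma lqsum_attained q b : (1 <= q)%E -> (forall i, 0 <= b i) ->
  exists a, [/\ forall i, 0 <= a i, (lqsum q predT (EFin \o a) <= 1)%E &
    (\sum_(i | P i) a i * b i)%:E = lqsum (conjexp q) P (EFin \o b)].
Proof.
case: q => [r| |]//.
- rewrite lee_fin le_eqVlt => /predU1P[<-|r1] b0.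
    rewrite [conjexp _]/= eqxx.
    case: (pickP P) => [i0 Pi0|P0]; last first.
      exists (fun=> 0); split => //; last by rewrite /= !big_pred0.
      rewrite lqsum_fin// big1 => [|i _]; last by rewrite powRr1.
      by rewrite invr1 powRr1// lee_fin ler01.
    pose j := [arg max_(i > i0 | P i) b i]%O.
    have [Pj bj] : P j /\ forall i, P i -> b i <= b j.
      by rewrite /j; case: arg_maxP => // k Pk bk; split => // i /bk.
    exists (fun i => (i == j)%:R); split => [i| |].
    + by [].
    + rewrite lqsum_fin// (bigD1 j)//= eqxx big1 => [|i /negbTE ->]; last first.
        by rewrite powRr1.
      by rewrite addr0 !powR1.
    + transitivity (b j)%:E.
        congr EFin; rewrite (bigD1 j)//= eqxx mul1r big1 ?addr0// => i.
        by move=> /andP[_ /negbTE ->]; rewrite mul0r.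
      apply/eqP; rewrite eq_le; apply/andP; split.
        exact: (le_bigmax_cond _ (EFin \o b)).
      by apply: bigmax_le => [|i Pi]; rewrite lee_fin// bj.
  have r0 : 0 < r by rewrite (lt_trans ltr01).
  have rB : 0 < r - 1 by rewrite subr_gt0.
  rewrite [conjexp _]/= gt_eqF//; set t := r / (r - 1).
  have t0 : 0 < t by rewrite divr_gt0.
  have tE : t - 1 = (r - 1)^-1 by rewrite /t; field; rewrite gt_eqF.
  have tr : (t - 1) * r = t by rewrite tE mulrC.
  rewrite lqsum_fin//; set S := \sum_(i | P i) b i `^ t.
  have S0 : 0 <= S by apply: sumr_ge0 => i _; exact: powR_ge0.
  (* Zero outside [P], so that the norm over all indices is the one over [P]. If [S = 0], the factor
     in [S] is 0 and so is [a]. *)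
  pose a i := if P i then S `^ (- r^-1) * b i `^ (t - 1) else 0.
  have a0 i : 0 <= a i by rewrite /a; case: ifP => // _; rewrite mulr_ge0 ?powR_ge0.
  exists a; split => //.
  + rewrite lqsum_fin// lee_fin.
    have -> : \sum_i a i `^ r = S^-1 * S.
      rewrite /S mulr_sumr [RHS]big_mkcond/=; apply: eq_bigr => i _.
      rewrite /a; case: ifP => _; last by rewrite powR0// gt_eqF.
      rewrite powRM ?powR_ge0// -!powRrM tr mulNr mulVf ?gt_eqF//.
      by rewrite powRN powRr1.
    have [->|Sn0] := eqVneq S 0; last by rewrite mulVf// powR1.
    by rewrite mulr0 powR0// invr_eq0 gt_eqF.
  + congr EFin.
    transitivity (S `^ (- r^-1) * S).
      rewrite /S mulr_sumr; apply: eq_bigr => i Pi; rewrite /a Pi -mulrA.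
      by congr (_ * _); rewrite mulrC mulr_powRB1.
    have [->|Sn0] := eqVneq S 0; first by rewrite mulr0 powR0// invr_eq0 gt_eqF.
    have -> : t^-1 = 1 - r^-1 by rewrite /t; field; rewrite !gt_eqF.
    by rewrite powRB ?Sn0 ?implybT// powRr1// powRN mulrC.
- move=> _ b0; exists (fun=> 1); split => //.
    by rewrite /=; apply: bigmax_le => // _; rewrite lee01.
  rewrite [conjexp _]/= lqsum_fin// invr1 powRr1.
    by congr EFin; apply: eq_bigr => i _; rewrite mul1r powRr1.
  by apply: sumr_ge0 => i _; exact: powR_ge0.
Qed.

End DiscreteDuality.

(** * The worst-case error *)

Section WorstCase.
Context {R : realType}.
Variables (s N : nat) (a : R) (p q : \bar R) (X : 'I_N -> s.-tuple R).
Hypotheses (a01 : 0 < a <= 1) (ap : (a^-1%:E < p)%E) (q1 : (1 <= q)%E).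
Hypotheses (N0 : (0 < N)%N) (cX : forall n, cube s (X n)).

Let p1 : (1 < p)%E := gt1_exponent _ _ a01 ap.
Let p0 : (0 < p)%E. Proof. exact: lt_trans lte01 p1. Qed.
Let cp0 : (0 < conjexp p)%E.
Proof.
have [r [-> r1 _]] := conjexp_bounds _ _ a01 ap.
by rewrite lte_fin (lt_le_trans ltr01).
Qed.

Local Notation D := (Delta_kern s N a X).
Let c (u : {set 'I_s}) : R := (Gamma a)^-1 ^+ #|u|.
Let b (u : {set 'I_s}) : R :=
  fine (Lnorm (cube_prob #|u|) (conjexp p) (EFin \o D u)).

Let c_gt0 (u : {set 'I_s}) : 0 < c u.
Proof. by rewrite exprn_gt0// invr_gt0 Gamma_gt0. Qed.

Let bE (u : {set 'I_s}) :
  Lnorm (cube_prob #|u|) (conjexp p) (EFin \o D u) = (b u)%:E.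
Proof.
have /andP[_] := Delta_kern_Lfun s N a p X a01 ap cX u; rewrite inE/= => h.
by rewrite /b fineK// ge0_fin_numE// Lnorm_ge0.
Qed.

Let b_ge0 (u : {set 'I_s}) : 0 <= b u. Proof. by rewrite fine_ge0// Lnorm_ge0. Qed.

(** All kernels are empty products, so the value is 1 minus the average of [N] ones; here [N > 0]
    matters. *)
Let Delta_set0 t : D finset.set0 t = 0.
Proof.
have k1 (d : R) x : kern s d finset.set0 x t = 1.
  by apply: big1 => -[m m0]; exfalso; move: m0; rewrite cards0.
rewrite /Delta_kern k1; under eq_bigr do rewrite k1.
rewrite sumr_const card_ord cards0 expr0 invr1 mulr1 mulVf ?subrr//.
by rewrite pnatr_eq0 -lt0n.
Qed.

Let b_set0 : b finset.set0 = 0.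
Proof.
rewrite /b (_ : D finset.set0 = cst 0) ?Lnorm0 ?gt_eqF//.
by apply/funext => t; exact: Delta_set0.
Qed.

Let DstarE : Dstar s a (conjexp p) (conjexp q) N X =
  lqsum (conjexp q) [pred u : {set 'I_s} | u != finset.set0] (EFin \o b).
Proof.
rewrite /Dstar; congr lqsum; apply/funext => u /=.
rewrite (eq_Lpn _ _ _ (D u)); last by move=> t; exact: Delta_kernE.
by rewrite Lpn_Lnorm//; exact: measurable_Delta_kern.
Qed.

Let sum_b (d : {set 'I_s} -> R) :
  \sum_u d u * b u = \sum_(u | u != finset.set0) d u * b u.
Proof.
by rewrite (bigD1 finset.set0)//= b_set0 mulr0 add0r.
Qed.

Lemma Hball_error_le f : Hball s a p q f ->
  (`|\int[lebn s]_(x in cube s) (f x)%:E - (QP s N X f)%:E| <=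
   Dstar s a (conjexp p) (conjexp q) N X)%E.
Proof.
move=> [F0 [F0p [F0f F0q]]].
(* The given family is measurable on the cubes only. Extension by zero makes it measurable
   everywhere and changes neither the norms nor the representation. *)
pose F : @Defs.family R s := fun u => (F0 u) \_ (cube #|u|).
have FE (u : {set 'I_s}) t : cube #|u| t -> F u t = F0 u t.
  by move=> ct; rewrite /F patchE mem_set.
have mF (u : {set 'I_s}) : measurable_fun [set: #|u|.-tuple R] (F u).
  exact: (measurable_restrictT (F0 u) (measurable_cube #|u|)).1 (F0p u).1.
have FpE (u : {set 'I_s}) :
    Lpn #|u| p (F0 u) = Lnorm (cube_prob #|u|) p (EFin \o F u).
  by rewrite -Lpn_Lnorm//; apply: eq_Lpn => t ct; rewrite FE.
have Fp (u : {set 'I_s}) : (Lnorm (cube_prob #|u|) p (EFin \o F u) < +oo)%E.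
  by rewrite -FpE; exact: (F0p u).2.
have Ff : represents s a F f.
  move=> x cx; rewrite F0f//; apply: eq_bigr => u _; congr (_ * _)%E.
  rewrite !integral_lebn_cube; apply: eq_integral => t; rewrite inE => ct.
  by rewrite FE.
rewrite (error_formula s N a p X a01 ap cX F f mF Fp Ff).
pose l (u : {set 'I_s}) := fine (Lnorm (cube_prob #|u|) p (EFin \o F u)).
have lE (u : {set 'I_s}) : Lnorm (cube_prob #|u|) p (EFin \o F u) = (l u)%:E.
  by rewrite /l fineK// ge0_fin_numE// Lnorm_ge0.
have l0 (u : {set 'I_s}) : 0 <= l u by rewrite fine_ge0// Lnorm_ge0.
pose e (u : {set 'I_s}) := fine (\int[cube_prob #|u|]_t (F u t * D u t)%:E).
have iFD (u : {set 'I_s}) := integrable_dual_pairing _ _ _ _ _ _ _ p1 (mF u) (Fp u)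
  (Delta_kern_Lfun s N a p X a01 ap cX u).
have eE (u : {set 'I_s}) : (\int[cube_prob #|u|]_t (F u t * D u t)%:E = (e u)%:E)%E.
  by rewrite /e fineK//; exact: integrable_fin_num (iFD u).
have le_e (u : {set 'I_s}) : `|e u| <= l u * b u.
  rewrite -lee_fin EFinM -lE -bE.
  apply: le_trans (hoelder_conjexp _ _ _ _ _ _ _ p1 (mF u)
    (measurable_Delta_kern s N a X u)).
  rewrite -abse_EFin -eE; apply: le_abse_integral => //.
  by have /integrableP[] := iFD u.
have -> : (\sum_(u : {set 'I_s}) ((Gamma a)^-1 ^+ #|u|)%:E *
    \int[cube_prob #|u|]_t (F u t * D u t)%:E)%E = (\sum_u c u * e u)%:E.
  by rewrite -sumEFin; apply: eq_bigr => u _; rewrite eE.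
(* Grouped so that [c u * l u] is the term of [Hnorm] belonging to [u]. *)
apply: (@le_trans _ _ (\sum_u (c u * l u) * b u)%:E).
  rewrite abse_EFin lee_fin; apply: le_trans (ler_norm_sum _ _ _) _.
  apply: ler_sum => u _; rewrite normrM gtr0_norm// -mulrA.
  by apply: ler_wpM2l => //; exact: ltW.
rewrite sum_b DstarE; apply: lqsum_hoelder => // [u|].
  by rewrite mulr_ge0// ltW.
rewrite (le_trans _ F0q)// /Hnorm le_eqVlt; apply/orP; left; apply/eqP.
by congr lqsum; apply/funext => u /=; rewrite FpE lE.
Qed.

(** The two extremal constructions are nested: [d] distributes the norm over the sets [u], and each
    [F u] is extremal against [D u] with its share. Every term of the error is then nonnegative, so
    nothing cancels. *)
Lemma Hball_error_attained : exists2 f, Hball s a p q f &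
  (`|\int[lebn s]_(x in cube s) (f x)%:E - (QP s N X f)%:E| =
   Dstar s a (conjexp p) (conjexp q) N X)%E.
Proof.
have [d [d0 dq db]] := lqsum_attained
  [pred u : {set 'I_s} | u != finset.set0] q b q1 b_ge0.
(* The share of [u] is divided by [c u], since [Hnorm] weights the norm of [F u] with [c u]. *)
have dc0 (u : {set 'I_s}) : 0 <= (c u)^-1 * d u by rewrite mulr_ge0// invr_ge0 ltW.
pose F : @Defs.family R s := fun u => sval (cid (Lnorm_attained _ _ _
  (cube_prob #|u|) p (D u) _ p1 (dc0 u) (Delta_kern_Lfun s N a p X a01 ap cX u))).
have FP (u : {set 'I_s}) : [/\ measurable_fun [set: #|u|.-tuple R] (F u),
    (Lnorm (cube_prob #|u|) p (EFin \o F u) <= ((c u)^-1 * d u)%:E)%E &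
    \int[cube_prob #|u|]_t (F u t * D u t)%:E = ((c u)^-1 * d u)%:E * (b u)%:E]%E.
  by rewrite -bE; exact: (svalP (cid (Lnorm_attained _ _ _
    (cube_prob #|u|) p (D u) _ p1 (dc0 u) (Delta_kern_Lfun s N a p X a01 ap cX u)))).
have mF (u : {set 'I_s}) : measurable_fun [set: #|u|.-tuple R] (F u).
  by have [] := FP u.
have Fp (u : {set 'I_s}) : (Lnorm (cube_prob #|u|) p (EFin \o F u) < +oo)%E.
  by have [_ h _] := FP u; exact: le_lt_trans h (ltry _).
(* On the cube all terms are finite by Hoelder, so [fine] loses nothing there; [represents] asks for
   no more. *)
pose f (x : s.-tuple R) := fine (\sum_(u : {set 'I_s})
  ((Gamma a)^-1 ^+ #|u|)%:E *
  \int[lebn #|u|]_(t in cube #|u|) (F u t * kern s a u x t)%:E)%E.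
have Ff : represents s a F f.
  move=> x cx; rewrite /f fineK//; apply/sum_fin_numP => u _ _.
  rewrite fin_numM// integral_lebn.
    apply: integrable_fin_num => //.
    exact: (integrable_dual_pairing _ _ _ _ _ _ _ p1 (mF u) (Fp u)
      (kern_Lfun_conjexp _ _ _ _ a01 ap _ cx)).
  apply/measurable_EFinP; apply: measurable_funM; first exact: mF.
  exact: measurable_kern.
exists f.
  exists F; split; [|split => //].
    move=> u; split; first exact: measurable_funTS (mF u).
    by rewrite Lpn_Lnorm.
  (* Monotonicity suffices and is what is available: [c u] times the norm of [F u] is only known to
     be at most [d u]. *)
  apply: le_trans dq; apply: le_lqsum.
  - exact: lt_le_trans lte01 q1.
  - by move=> u; rewrite mule_ge0 ?lee_fin ?(ltW (c_gt0 u))// Lpn_Lnorm// Lnorm_ge0.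
  move=> u; rewrite Lpn_Lnorm//=.
  have [_ h _] := FP u.
  apply: le_trans (lee_wpmul2l _ h) _; first by rewrite lee_fin (ltW (c_gt0 u)).
  by rewrite -/(c u) -EFinM mulVKf ?gt_eqF.
rewrite (error_formula s N a p X a01 ap cX F f mF Fp Ff) DstarE -db -sum_b.
have -> : (\sum_(u : {set 'I_s}) ((Gamma a)^-1 ^+ #|u|)%:E *
    \int[cube_prob #|u|]_t (F u t * D u t)%:E)%E = (\sum_u d u * b u)%:E.
  rewrite -sumEFin; apply: eq_bigr => u _; have [_ _ ->] := FP u.
  by rewrite -/(c u) -!EFinM mulrA mulVKf ?gt_eqF.
by rewrite abse_EFin ger0_norm// sumr_ge0// => u _; rewrite mulr_ge0.
Qed.

End WorstCase.

Theorem theorem6 (R : realType) (s : nat) (alpha : R) (p q : \bar R)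
    (N : nat) (X : 'I_N -> s.-tuple R) :
  (0 < s)%N -> 0 < alpha <= 1 -> (alpha^-1%:E < p)%E -> (1 <= q)%E ->
  (0 < N)%N -> (forall n, cube s (X n)) ->
  ewor s alpha p q N X = Dstar s alpha (conjexp p) (conjexp q) N X.
Proof.
move=> _ a01 ap q1 N0 cX; apply/eqP; rewrite eq_le; apply/andP; split.
  by apply: ge_ereal_sup => _ [f Hf <-]; exact: Hball_error_le.
have [f Hf <-] := Hball_error_attained s N alpha p q X a01 ap q1 N0 cX.
by apply: ereal_sup_ubound; exists f.
Qed.
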